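(* In the binary random graph affiliation mixture model with $Q\ge 2$ groups, for any fixed and known values $\pi_q\in(0,1)$, $1\le q\le Q$, the parameters $\alpha,\beta$ are identifiable from the joint distribution of $K_3$: if $(\alpha,\beta)$ and $(\alpha',\beta')$ together with the same $\boldsymbol\pi$ induce the same law of $K_3$, then $(\alpha,\beta)=(\alpha',\beta')$.
   Context: Random graph mixture model: nodes have i.i.d. latent groups $Z_i\in\{1,\dots,Q\}$ with $\pi_q=\mathbb P(Z_i=q)\in(0,1)$, $\sum_q\pi_q=1$; edge variables $X_{ij}$ ($i<j$) are conditionally independent given all $Z$'s, with law of $X_{ij}$ depending only on $(Z_i,Z_j)$. Binary affiliation model: $X_{ij}\in\{0,1\}$ with $\mathbb P(X_{ij}=1\mid Z_i=q,Z_j=l)=\alpha$ if $q=l$ and $=\beta$ if $q\ne l$. $K_n$ denotes the collection of the $\binom n2$ edge variables among a set of $n$ nodes. *)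

(* Defs.v *)
(* Probabilities live in an arbitrary real closed field R
   (e.g. the real numbers); the model only involves finite sums/products. *)
From HB Require Import structures.
From mathcomp Require Import all_boot all_order all_algebra.
Set Implicit Arguments. Unset Strict Implicit. Unset Printing Implicit Defensive.
Import Order.TTheory GRing.Theory Num.Theory.
Local Open Scope ring_scope.

Definition affil_conn (R : rcfType) (Q : nat) (alpha beta : R) (q l : 'I_Q) : R :=
  if q == l then alpha else beta.

Definition bern (R : rcfType) (p : R) (b : bool) : R :=
  if b then p else 1 - p.

Definition proportions (R : rcfType) (Q : nat) (pi : 'I_Q -> R) : Prop :=
  (forall q, 0 < pi q < 1) /\ \sum_(q < Q) pi q = 1.

(* Joint law of K_3 = (X_12, X_13, X_23) on {0,1}^3 in the binary affiliation
   mixture model, obtained by summing over the i.i.d. latent groups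
   Z_1, Z_2, Z_3 with conditionally independent edges. *)
Definition affil_K3_law (R : rcfType) (Q : nat) (pi : 'I_Q -> R) (alpha beta : R)
    (x12 x13 x23 : bool) : R :=
  \sum_(z1 < Q) \sum_(z2 < Q) \sum_(z3 < Q)
     pi z1 * pi z2 * pi z3
     * bern (affil_conn alpha beta z1 z2) x12
     * bern (affil_conn alpha beta z1 z3) x13
     * bern (affil_conn alpha beta z2 z3) x23.

(* Main.v *)
(* Writing d = alpha - beta and s_k = \sum_q pi_q^k, the marginals of the law of
   K_3 are P(X12 = 1) = beta + d s_2, P(X12 = X13 = 1) = beta^2 + 2 beta d s_2
   + d^2 s_3 and P(X12 = X13 = X23 = 1) = beta^3 + 3 beta^2 d s_2
   + (3 beta d^2 + d^3) s_3.  In the joint cumulant of the three edges beta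
   cancels, leaving d^3 (s_3 - 3 s_2 s_3 + 2 s_2^3).  This last factor is
   positive: with M = max_q pi_q < 1 we have M^2 <= s_2 <= M and s_3 <= M s_2.
   So the law of K_3 determines d^3, hence d, and then beta from P(X12 = 1). *)

Require Import Defs.
From HB Require Import structures.
From mathcomp Require Import all_boot all_order all_algebra.
From mathcomp Require Import ring lra.
Import Order.TTheory GRing.Theory Num.Theory.
Set Implicit Arguments.
Unset Strict Implicit.
Unset Printing Implicit Defensive.
Local Open Scope ring_scope.

Definition power_sum (R : pzSemiRingType) (Q : nat) (pi : 'I_Q -> R) (k : nat) : R :=
  \sum_(q < Q) pi q ^+ k.

Definition edge_prob (R : pzSemiRingType) (L : bool -> bool -> bool -> R) : R :=
  \sum_(x13 : bool) \sum_(x23 : bool) L true x13 x23.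

Definition cherry_prob (R : pzSemiRingType) (L : bool -> bool -> bool -> R) : R :=
  \sum_(x23 : bool) L true true x23.

(* By exchangeability of the three edges, this is their joint cumulant
   E[X12 X13 X23] - 3 E[X12 X13] E[X12] + 2 E[X12]^3. *)
Definition triangle_cumulant (R : pzRingType) (L : bool -> bool -> bool -> R) : R :=
  L true true true - 3 * cherry_prob L * edge_prob L + 2 * edge_prob L ^+ 3.

(* The [triangle_cumulant] of the model with [alpha = 1] and [beta = 0], whose
   edges are the indicators of [Z_i = Z_j]. *)
Definition pi_cumulant (R : pzRingType) (Q : nat) (pi : 'I_Q -> R) : R :=
  power_sum pi 3 - 3 * power_sum pi 2 * power_sum pi 3 + 2 * power_sum pi 2 ^+ 3.

Lemma expr3_inj (R : realDomainType) (x y : R) : x ^+ 3 = y ^+ 3 -> x = y.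
Proof.
move=> h; have : (x - y) * (x ^+ 2 + x * y + y ^+ 2) = 0.
  by transitivity (x ^+ 3 - y ^+ 3); [ring | rewrite h subrr].
move/eqP; rewrite mulf_eq0 => /orP[/eqP/subr0_eq // | /eqP h0].
have : x ^+ 2 <= 0 by nra.
have : y ^+ 2 <= 0 by nra.
by rewrite !exprn_even_le0 //= => /eqP -> /eqP ->.
Qed.

Lemma moment_cumulant_gt0 (R : realFieldType) (M m2 m3 : R) :
  0 < M < 1 -> M ^+ 2 <= m2 <= M -> 0 <= m3 <= M * m2 ->
  0 < m3 - 3 * m2 * m3 + 2 * m2 ^+ 3.
Proof.
move=> /andP[M_gt0 M_lt1] /andP[M2_le m2_le] /andP[m3_ge0 m3_le].
have m2_gt0 : 0 < m2 by nra.
have quad_gt0 : 0 < 2 * m2 ^+ 2 - 3 * M * m2 + M.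
  have [m2_small|m2_big] := lerP (2 * m2) M; first nra.
  have : (M - m2) * (2 * m2 - M) <= M * (1 - M) * M by apply: ler_pM; lra.
  have : 0 < M * (1 - M) * (1 - M) by apply: mulr_gt0; [apply: mulr_gt0|]; lra.
  nra.
have [m2_small|m2_big] := lerP (3 * m2) 1.
  have : 0 <= m3 * (1 - 3 * m2) by apply: mulr_ge0; lra.
  have : 0 < m2 ^+ 3 by exact: exprn_gt0.
  lra.
have : 0 <= (3 * m2 - 1) * (M * m2 - m3) by apply: mulr_ge0; lra.
have : 0 < m2 * (2 * m2 ^+ 2 - 3 * M * m2 + M) by exact: mulr_gt0.
lra.
Qed.

Lemma power_sumS_le (R : realDomainType) (Q : nat) (pi : 'I_Q -> R) (M : R) k :
  (forall q, 0 <= pi q <= M) -> power_sum pi k.+1 <= M * power_sum pi k.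
Proof.
move=> pi_bnd; rewrite /power_sum mulr_sumr; apply: ler_sum => q _.
have /andP[pi_ge0 pi_le] := pi_bnd q.
by rewrite exprS ler_wpM2r // exprn_ge0.
Qed.

Lemma pi_cumulant_gt0 (R : rcfType) (Q : nat) (pi : 'I_Q -> R) :
  (0 < Q)%N -> proportions pi -> 0 < pi_cumulant pi.
Proof.
move=> Q_gt0 [pi01 sum_pi].
have [m _ pi_max] := arg_maxP pi (isT : xpredT (Ordinal Q_gt0)).
have pi_bnd q : 0 <= pi q <= pi m.
  by case/andP: (pi01 q) => /ltW -> _; exact: pi_max.
apply: (@moment_cumulant_gt0 _ (pi m)); first exact: pi01.
  apply/andP; split.
    rewrite /power_sum (bigD1 m) //= lerDl.
    by apply: sumr_ge0 => q _; rewrite exprn_ge0 //; case/andP: (pi_bnd q).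
  have power_sum1 : power_sum pi 1 = 1.
    by rewrite -sum_pi; apply: eq_bigr => q _; rewrite expr1.
  by have := power_sumS_le 1 pi_bnd; rewrite power_sum1 mulr1.
apply/andP; split; last exact: power_sumS_le.
by apply: sumr_ge0 => q _; rewrite exprn_ge0 //; case/andP: (pi_bnd q).
Qed.

Section AffiliationLaw.
Variables (R : rcfType) (Q : nat) (pi : 'I_Q -> R).
Hypothesis sum_pi : \sum_(q < Q) pi q = 1.
Variables alpha beta : R.
Local Notation c := (affil_conn alpha beta).

Lemma sum_affil_conn (F : 'I_Q -> R) (g : R -> R) q :
  \sum_l F l * g (c q l) = g beta * \sum_l F l + (g alpha - g beta) * F q.
Proof.
rewrite (bigD1 q) //= [in RHS](bigD1 q) //= /affil_conn eqxx.
rewrite (eq_bigr (fun l => g beta * F l)) -?mulr_sumr; first ring.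
by move=> l; rewrite eq_sym => /negbTE ->; rewrite mulrC.
Qed.

Lemma sum_pi_quadratic (a b d : R) :
  \sum_q pi q * (a + b * pi q + d * pi q ^+ 2)
  = a + b * power_sum pi 2 + d * power_sum pi 3.
Proof.
rewrite (eq_bigr (fun q => a * pi q + b * pi q ^+ 2 + d * pi q ^+ 3)) => [|q _].
  by rewrite !big_split -!mulr_sumr sum_pi mulr1.
ring.
Qed.

Lemma sum_pi_affil_conn q : \sum_l pi l * c q l = beta + (alpha - beta) * pi q.
Proof. by rewrite (sum_affil_conn pi id) sum_pi mulr1. Qed.

Let group_mean (f : 'I_Q -> 'I_Q -> 'I_Q -> R) :=
  \sum_z1 pi z1 * \sum_z2 pi z2 * \sum_z3 pi z3 * f z1 z2 z3.

Lemma affil_K3_lawE x12 x13 x23 : affil_K3_law pi alpha beta x12 x13 x23 =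
  group_mean (fun z1 z2 z3 => bern (c z1 z2) x12 * bern (c z1 z3) x13 * bern (c z2 z3) x23).
Proof.
apply: eq_bigr => z1 _; rewrite mulr_sumr; apply: eq_bigr => z2 _.
rewrite !mulr_sumr; apply: eq_bigr => z3 _; ring.
Qed.

Lemma group_meanD f g : group_mean f + group_mean g = group_mean (fun z1 z2 z3 => f z1 z2 z3 + g z1 z2 z3).
Proof.
rewrite /group_mean -big_split /=; apply: eq_bigr => z1 _; rewrite -mulrDr -big_split /=.
congr (_ * _); apply: eq_bigr => z2 _; rewrite -mulrDr -big_split /=.
by congr (_ * _); apply: eq_bigr => z3 _; rewrite -mulrDr.
Qed.

Lemma eq_group_mean f g : (forall z1 z2 z3, f z1 z2 z3 = g z1 z2 z3) -> group_mean f = group_mean g.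
Proof.
move=> fg; apply: eq_bigr => z1 _; congr (_ * _); apply: eq_bigr => z2 _.
by congr (_ * _); apply: eq_bigr => z3 _; rewrite fg.
Qed.

Lemma law_edge :
  edge_prob (affil_K3_law pi alpha beta)
  = beta + (alpha - beta) * power_sum pi 2.
Proof.
rewrite /edge_prob !big_bool /= !affil_K3_lawE !group_meanD.
rewrite (@eq_group_mean _ (fun z1 z2 _ => c z1 z2)) => [|z1 z2 z3]; last by rewrite /bern; ring.
transitivity (\sum_z1 pi z1 * (beta + (alpha - beta) * pi z1 + 0 * pi z1 ^+ 2)).
  apply: eq_bigr => z1 _; rewrite mul0r addr0 -sum_pi_affil_conn; congr (_ * _).
  by apply: eq_bigr => z2 _; rewrite -mulr_suml sum_pi mul1r.
by rewrite sum_pi_quadratic mul0r addr0.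
Qed.

Lemma law_cherry :
  cherry_prob (affil_K3_law pi alpha beta)
  = beta ^+ 2 + 2 * beta * (alpha - beta) * power_sum pi 2
    + (alpha - beta) ^+ 2 * power_sum pi 3.
Proof.
rewrite /cherry_prob big_bool /= !affil_K3_lawE group_meanD.
rewrite (@eq_group_mean _ (fun z1 z2 z3 => c z1 z2 * c z1 z3)) => [|z1 z2 z3]; last by rewrite /bern; ring.
rewrite /group_mean -sum_pi_quadratic; apply: eq_bigr => z1 _; congr (_ * _).
transitivity (\sum_z2 pi z2 * c z1 z2 * (beta + (alpha - beta) * pi z1)).
  apply: eq_bigr => z2 _; rewrite -mulrA -sum_pi_affil_conn !mulr_sumr.
  by apply: eq_bigr => z3 _; ring.
by rewrite -mulr_suml sum_pi_affil_conn; ring.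
Qed.

Lemma law_triangle :
  affil_K3_law pi alpha beta true true true
  = beta ^+ 3 + 3 * beta ^+ 2 * (alpha - beta) * power_sum pi 2
    + (3 * beta * (alpha - beta) ^+ 2 + (alpha - beta) ^+ 3) * power_sum pi 3.
Proof.
rewrite affil_K3_lawE (@eq_group_mean _ (fun z1 z2 z3 => c z1 z2 * c z1 z3 * c z2 z3)) //.
pose d := alpha - beta.
transitivity (\sum_z1 pi z1 * (beta ^+ 3 + d * beta ^+ 2 * power_sum pi 2
   + 2 * beta ^+ 2 * d * pi z1 + (beta * d ^+ 2 + d * (alpha ^+ 2 - beta ^+ 2)) * pi z1 ^+ 2));
  last by rewrite sum_pi_quadratic /d; ring.
apply: eq_bigr => z1 _; congr (_ * _).
have inner z2 : \sum_z3 pi z3 * (c z1 z2 * c z1 z3 * c z2 z3)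
    = c z1 z2 * (beta * (beta + d * pi z1) + d * (pi z2 * c z1 z2)).
  rewrite (eq_bigr (fun z3 => c z1 z2 * ((pi z3 * c z1 z3) * c z2 z3))) => [|z3 _]; last ring.
  by rewrite -mulr_sumr (sum_affil_conn (fun z3 => pi z3 * c z1 z3) id) sum_pi_affil_conn.
rewrite (eq_bigr (fun z2 => beta * (beta + d * pi z1) * (pi z2 * c z1 z2)
                            + d * (pi z2 ^+ 2 * c z1 z2 ^+ 2))) => [|z2 _]; last by rewrite inner; ring.
rewrite big_split /= -!mulr_sumr sum_pi_affil_conn.
rewrite (sum_affil_conn (fun z2 => pi z2 ^+ 2) (fun x => x ^+ 2)) -/(power_sum pi 2) /d; ring.
Qed.

Lemma affil_triangle_cumulant :
  triangle_cumulant (affil_K3_law pi alpha beta) = (alpha - beta) ^+ 3 * pi_cumulant pi.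
Proof. by rewrite /triangle_cumulant law_edge law_cherry law_triangle /pi_cumulant; ring. Qed.

End AffiliationLaw.

Theorem corollary2 (R : rcfType) (Q : nat) (pi : 'I_Q -> R)
    (alpha beta alpha' beta' : R) :
  (2 <= Q)%N ->
  proportions pi ->
  0 <= alpha <= 1 -> 0 <= beta <= 1 ->
  0 <= alpha' <= 1 -> 0 <= beta' <= 1 ->
  (forall x12 x13 x23 : bool,
     affil_K3_law pi alpha beta x12 x13 x23
     = affil_K3_law pi alpha' beta' x12 x13 x23) ->
  (alpha, beta) = (alpha', beta').
Proof.
move=> Q_ge2 pi_prop _ _ _ _ same_law.
have cumulant_gt0 := pi_cumulant_gt0 (ltnW Q_ge2) pi_prop.
have [_ sum_pi] := pi_prop.
have same_edge : edge_prob (affil_K3_law pi alpha beta)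
               = edge_prob (affil_K3_law pi alpha' beta').
  by rewrite /edge_prob !big_bool /= !same_law.
have same_cumulant : triangle_cumulant (affil_K3_law pi alpha beta)
                   = triangle_cumulant (affil_K3_law pi alpha' beta').
  by rewrite /triangle_cumulant /cherry_prob same_edge !big_bool /= !same_law.
have same_gap : alpha - beta = alpha' - beta'.
  apply: expr3_inj; apply: (mulIf (lt0r_neq0 cumulant_gt0)).
  by rewrite -!affil_triangle_cumulant.
move: same_edge; rewrite !law_edge // same_gap => /addIr same_beta.
by move: same_gap; rewrite same_beta => /addIr ->.
Qed.
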